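(* Let $X$ be a topological space. (a) $X$ is sequentially compact if and only if, for every open cover $\{O_a\mid a\in[\omega]^\omega\}$ of $X$ such that $\{O_a\mid a\in[Z]^\omega\}$ is still a cover of $X$ for every $Z\in[\omega]^\omega$, there is $n\in\omega$ such that $\{O_a\mid n\in a\in[\omega]^\omega\}$ is a cover of $X$. (b) $X$ is sequentially feebly compact if and only if, for every open cover $\{O_a\mid a\in[\omega]^\omega\}$ of $X$ such that $\{O_a\mid a\in[Z]^\omega\}$ is still a cover of $X$ for every $Z\in[\omega]^\omega$, there is $n\in\omega$ such that $\{O_a\mid n\in a\in[\omega]^\omega\}$ is dense in $X$.
   Context: No separation axiom is assumed. For $W\subseteq\omega$ infinite, $[W]^\omega$ denotes the set of all infinite subsets of $W$. Covers are indexed families (repetitions allowed). A family of subsets of $X$ is dense in $X$ if its union is dense in $X$. $X$ is sequentially compact if every sequence $(x_n)_{n\in\omega}$ of points of $X$ has a convergent subsequence; equivalently, there are $x\in X$ and an infinite $Z\subseteq\omega$ such that $Z\setminus\{n\mid x_n\in U\}$ is finite for every open neighborhood $U$ of $x$. $X$ is sequentially feebly compact (also called sequentially pseudocompact) if, for every sequence $(O_n)_{n\in\omega}$ of nonempty open sets of $X$, there are $x\in X$ and an infinite $Z\subseteq\omega$ such that, for every open neighborhood $U$ of $x$, the set $Z\setminus\{n\in\omega\mid O_n\cap U\neq\emptyset\}$ is finite. *)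

(* Defs.v *)
From mathcomp Require Import all_boot all_order.
From mathcomp Require Import boolp classical_sets functions cardinality filter.
From mathcomp Require Import topology sequences.

Set Implicit Arguments.
Unset Strict Implicit.
Unset Printing Implicit Defensive.

Local Open Scope classical_set_scope.

(* [W]^omega *)
Definition infinite_subsets (W : set nat) : set (set nat) :=
  [set a | a `<=` W /\ infinite_set a].

Definition sequentially_compact (X : topologicalType) : Prop :=
  forall x_ : nat -> X, exists f : nat -> nat,
    increasing_seq f /\ exists x : X, x_ \o f @ \oo --> x.

Definition sequentially_feebly_compact (X : topologicalType) : Prop :=
  forall O : nat -> set X, (forall n, open (O n) /\ O n !=set0) ->
  exists (x : X) (Z : set nat), infinite_set Z /\
    forall U : set X, open_nbhs x U ->
      finite_set (Z `\` [set n | O n `&` U !=set0]).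

(* The family is indexed by the infinite subsets of nat only: the values of O
   at finite sets are irrelevant. *)
Definition hereditary_open_cover (X : topologicalType)
    (O : set nat -> set X) : Prop :=
  [/\ forall a, infinite_subsets setT a -> open (O a),
      cover (infinite_subsets setT) O = setT &
      forall Z, infinite_subsets setT Z ->
        cover (infinite_subsets Z) O = setT].

(* Main.v *)
Require Import Defs.
From mathcomp Require Import all_boot all_order.
From mathcomp Require Import boolp classical_sets functions cardinality filter.
From mathcomp Require Import topology sequences.

(** Both equivalences are instances of one statement about a class [C] of
subsets of [X]: every sequence [F] of members of [C] has a subsequence, indexed
by an infinite [Z], that clusters to some point [x] in the sense that every
neighborhood of [x] meets all but finitely many [F n] with [n] in [Z], if and
only if every hereditary open cover [O] has an [n] such that the union of the
[O a] with [n] in [a] meets every member of [C] ([selection_cover_iff]).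
Singletons give part (a), nonempty open sets give part (b).

If a hereditary cover had no such [n], choose for each [n] a member [F n] of [C]
that misses every [O a] with [n] in [a], and let [x] and [Z] be as above.  Some
[O a] with [a] an infinite subset of [Z] contains [x], and it misses [F n] for
all [n] in [a]: infinitely many [n] in [Z] are lost.

If a sequence [F] had no such [x] and [Z], let [O a] be the interior of the
complement of the union of the [F n] with [n] in [a].  The failure of [Z] at
[x] says exactly that [x] belongs to some [O a] with [a] infinite and contained
in [Z], so [O] is a hereditary cover; and [F n] misses [O a] whenever [n] is in
[a], for every [n]. *)

Local Open Scope classical_set_scope.

Lemma near_infty_finite (P : set nat) :
  (\forall n \near \oo, P n) <-> finite_set (~` P).
Proof.
split=> [[N _ NP]|/finite_seqP[s Ps]].
  apply: sub_finite_set (finite_II N) => n nP /=.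
  by rewrite ltnNge; apply/negP => /NP.
exists (\max_(i <- s) i).+1 => // n /= sn; apply: contrapT => nP.
have sn' : n \in s by have : (~` P) n by []; rewrite Ps.
by move: sn; rewrite ltnNge leq_bigmax_seq.
Qed.

Section Selection.
Variable X : topologicalType.
Implicit Types (C : set (set X)) (F O : nat -> set X).

Definition has_convergent_selection F : Prop :=
  exists (x : X) (Z : set nat), infinite_set Z /\
    forall U : set X, open_nbhs x U ->
      finite_set (Z `\` [set n | F n `&` U !=set0]).

Lemma selection_meets_cover C (O : set nat -> set X) :
  (forall F, (forall n, C (F n)) -> has_convergent_selection F) ->
  hereditary_open_cover O ->
  exists n, forall A, C A ->
    A `&` cover [set a | infinite_subsets setT a /\ a n] O !=set0.
Proof.
move=> selC [O_open _ O_her]; apply: contrapT => /forallNP none.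
have /choice[F FP] : forall n, exists A, C A /\
    ~ (A `&` cover [set a | infinite_subsets setT a /\ a n] O !=set0).
  by move=> n; have /existsNP[A /not_implyP] := none n; exists A.
have [x [Z [Zoo Zx]]] := selC F (fun n => (FP n).1).
have : cover (infinite_subsets Z) O x by rewrite O_her.
case=> a [aZ aoo] Oax.
have aT : infinite_subsets setT a by [].
apply: aoo; apply: sub_finite_set (Zx (O a) (conj (O_open _ aT) Oax)).
move=> n an; split; first exact: aZ.
by case=> y [Fy Oay]; apply: (FP n).2; exists y; split=> //; exists a.
Qed.

Definition avoiding F (a : set nat) : set X := (~` \bigcup_(n in a) F n)°.

Lemma avoiding_disjoint F (a : set nat) n :
  a n -> F n `&` avoiding F a = set0.
Proof.
by move=> an; rewrite -subset0 => y [Fy /interior_subset]; apply; exists n.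
Qed.

Lemma avoiding_hereditary F :
  ~ has_convergent_selection F -> hereditary_open_cover (avoiding F).
Proof.
move=> noF.
have her Z : infinite_subsets setT Z ->
    cover (infinite_subsets Z) (avoiding F) = setT.
  case=> _ Zoo; rewrite -subTset => x _.
  have [U xU UZ] : exists2 U, open_nbhs x U &
      infinite_set (Z `\` [set n | F n `&` U !=set0]).
    apply: contrapT => noU; apply: noF; exists x, Z; split=> // U xU.
    by apply: contrapT => UZ; apply: noU; exists U.
  exists (Z `\` [set n | F n `&` U !=set0]); first by split=> // n [].
  rewrite /avoiding /interior nbhsE; exists U => // y Uy [n [_ FnU] Fny].
  by apply: FnU; exists y.
split=> //; first by move=> a _; exact: open_interior.
by apply: her; split=> //; exact: infinite_nat.
Qed.

Lemma selection_cover_iff C :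
  (forall F, (forall n, C (F n)) -> has_convergent_selection F) <->
  (forall O : set nat -> set X, hereditary_open_cover O ->
    exists n, forall A, C A ->
      A `&` cover [set a | infinite_subsets setT a /\ a n] O !=set0).
Proof.
split=> [selC O|covC F CF]; first exact: selection_meets_cover.
apply: contrapT => /avoiding_hereditary/covC[n /(_ _ (CF n))].
case=> y [Fy [a [_ an] Oay]].
by have : (F n `&` avoiding F a) y by []; rewrite avoiding_disjoint.
Qed.

(** Passing from a subsequence [u \o f] to its index set [range f], and back from
[Z] to an increasing enumeration [f] of elements of [Z]: as [f] is injective,
images and preimages under [f] of finite sets of indices are finite. *)
Lemma convergent_subsequenceP (u : nat -> X) :
  (exists f : nat -> nat, increasing_seq f /\
     exists x : X, u \o f @ \oo --> x) <->
  has_convergent_selection (fun n => [set u n]).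
Proof.
split=> [[f [f_incr [x ufx]]]|[x [Z [Zoo Zx]]]].
  have f_inj := increasing_seq_injective f_incr.
  exists x, (range f); split.
    move=> /(finite_preimage (in2W f_inj)).
    by rewrite preimage_range; exact: infinite_nat.
  move=> U /open_nbhs_nbhs/ufx/near_infty_finite Ufin.
  apply: sub_finite_set (finite_image f Ufin) => _ [[k _ <-] kU].
  by exists k => // Uk; apply: kU; exists (u (f k)).
have [|f [f_incr _ fZ]] := infinite_increasing_seq_wf _ Zoo 0.
  by move=> n; apply: sub_finite_set (finite_II n.+1) => m /=.
have f_inj := increasing_seq_injective f_incr.
exists f; split=> //; exists x => V; rewrite nbhsE => -[U xU UV].
apply/near_infty_finite.
apply: sub_finite_set (finite_preimage (in2W f_inj) (Zx U xU)) => k Vk.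
by split=> // -[_ [-> /UV]].
Qed.

Lemma sequentially_compactP :
  sequentially_compact X <->
  (forall F, (forall n, range (@set1 X) (F n)) -> has_convergent_selection F).
Proof.
split=> [Xsc F rF|selX u].
  have /choice[u uF] : forall n, exists y, [set y] = F n.
    by move=> n; have [y _ <-] := rF n; exists y.
  have -> : F = fun n => [set u n].
    by apply/funext => n; rewrite uF.
  exact/convergent_subsequenceP/Xsc.
by apply/convergent_subsequenceP/selX => n; exists (u n).
Qed.

End Selection.

Theorem corollary5p12 (X : topologicalType) :
  (sequentially_compact X <->
     forall O : set nat -> set X, hereditary_open_cover O ->
       exists n : nat,
         cover [set a | infinite_subsets setT a /\ a n] O = setT) /\
  (sequentially_feebly_compact X <->
     forall O : set nat -> set X, hereditary_open_cover O ->
       exists n : nat,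
         dense (cover [set a | infinite_subsets setT a /\ a n] O)).
Proof.
split.
  rewrite sequentially_compactP selection_cover_iff.
  split=> covX O /covX[n On]; exists n.
    rewrite -subTset => x _.
    by have [|_ [-> Ox]] := On [set x]; first by exists x.
  by move=> _ [x _ <-]; exists x; rewrite On.
have := selection_cover_iff X [set A | open A /\ A !=set0].
rewrite /sequentially_feebly_compact => ->.
split=> covX O /covX[n On]; exists n.
  by move=> A A0 Aopen; exact: On.
by move=> A [Aopen A0]; exact: On.
Qed.
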